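(* Let $n\ge 1$ and let $u_i,v_i,k_i,x_i,y_i,l_i$ ($1\le i\le n+1$) be $6n+6$ independent commuting indeterminates. Write $(u,v,k;x,y,l)=(u_{n+1},v_{n+1},k_{n+1};x_{n+1},y_{n+1},l_{n+1})$. Let $$D_{n+1}(u,v,k;x,y,l)=\det\left(\frac{y_ju_i-x_jv_i}{l_j-k_i}\right)_{1\le i,j\le n+1},\qquad D_n=\det\left(\frac{y_ju_i-x_jv_i}{l_j-k_i}\right)_{1\le i,j\le n},$$ and let $U_n(u,v,k)$, $V_n(u,v,k)$, $X_n(x,y,l)$, $Y_n(x,y,l)$ be the quotients of bordered $(n+1)\times(n+1)$ determinants by $D_n$ defined in the context. Then, as an identity of rational functions in the indeterminates, $$\frac{D_{n+1}(u,v,k;x,y,l)}{D_n}=\frac{Y_n(x,y,l)\,U_n(u,v,k)-X_n(x,y,l)\,V_n(u,v,k)}{l-k}.$$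
   Context: All quantities are elements of the field of rational functions in the $6n+6$ indeterminates $u_i,v_i,k_i,x_i,y_i,l_i$, $1\le i\le n+1$. Put $u=u_{n+1}$, $v=v_{n+1}$, $k=k_{n+1}$, $x=x_{n+1}$, $y=y_{n+1}$, $l=l_{n+1}$. Let $A$ be the $n\times n$ matrix with entries $A_{ij}=\dfrac{y_ju_i-x_jv_i}{l_j-k_i}$, $1\le i,j\le n$, so that $D_n=\det A$. Let $r$ be the row vector of length $n$ with entries $r_j=\dfrac{y_ju-x_jv}{l_j-k}$, $1\le j\le n$. Let $c$ be the column vector of length $n$ with entries $c_i=\dfrac{yu_i-xv_i}{l-k_i}$, $1\le i\le n$. Then the following are quotients by $D_n$ of determinants of $(n+1)\times(n+1)$ block matrices: $$U_n=U_n(u,v,k)=\frac1{D_n}\begin{vmatrix}A&(u_i)_{1\le i\le n}\\ r&u\end{vmatrix},\qquad V_n=V_n(u,v,k)=\frac1{D_n}\begin{vmatrix}A&(v_i)_{1\le i\le n}\\ r&v\end{vmatrix},$$ where $(u_i)_{1\le i\le n}$ and $(v_i)_{1\le i\le n}$ are column vectors, and $$X_n=X_n(x,y,l)=\frac1{D_n}\begin{vmatrix}A&c\\ (x_j)_{1\le j\le n}&x\end{vmatrix},\qquad Y_n=Y_n(x,y,l)=\frac1{D_n}\begin{vmatrix}A&c\\ (y_j)_{1\le j\le n}&y\end{vmatrix},$$ where $(x_j)_{1\le j\le n}$ and $(y_j)_{1\le j\le n}$ are row vectors. The notation $U_n(u,v,k)$, etc., displays only the dependence on the variables of index $n+1$;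 the dependence on the variables of index $1,\dots,n$ is left implicit. *)

(* Defs.v *)
From HB Require Import structures.
From mathcomp Require Export all_boot all_algebra.
From mathcomp.multinomials Require Export mpoly.

Set Implicit Arguments.
Unset Strict Implicit.
Unset Printing Implicit Defensive.

Import GRing.Theory.
Local Open Scope ring_scope.

(* The ground field F is arbitrary. *)
Notation ratfun F n := {fraction {mpoly F[6 * n.+1]}}.

Section BorderedDeterminants.
Variables (F : fieldType) (n : nat).
Local Notation K := (ratfun F n).

(* mxvec_index is a bijection 'I_6 * 'I_n.+1 -> 'I_(6 * n.+1), so the families
   u_, v_, k_, x_, y_, l_ below list the 6n+6 indeterminates without repetition.
   Indices start at 0: the last one, n+1 in the usual numbering, is ord_max. *)
Definition indet (a : 'I_6) (i : 'I_n.+1) : K :=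
  tofrac ('X_(mxvec_index a i) : {mpoly F[6 * n.+1]}).

Definition u_ := indet (inord 0).
Definition v_ := indet (inord 1).
Definition k_ := indet (inord 2).
Definition x_ := indet (inord 3).
Definition y_ := indet (inord 4).
Definition l_ := indet (inord 5).

Definition Amx (m : nat) (le_mn : (m <= n.+1)%N) : 'M[K]_m :=
  \matrix_(i, j)
    let i' := widen_ord le_mn i in let j' := widen_ord le_mn j in
    (y_ j' * u_ i' - x_ j' * v_ i') / (l_ j' - k_ i').

Definition D (m : nat) (le_mn : (m <= n.+1)%N) : K := \det (Amx le_mn).

Local Notation A := (Amx (leqnSn n)).
Local Notation Dn := (D (leqnSn n)).
Local Notation old := (widen_ord (leqnSn n)).

Definition rrow (u v k : K) : 'rV[K]_n :=
  \row_j ((y_ (old j) * u - x_ (old j) * v) / (l_ (old j) - k)).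

Definition ccol (x y l : K) : 'cV[K]_n :=
  \col_i ((y * u_ (old i) - x * v_ (old i)) / (l - k_ (old i))).

Definition U (u v k : K) : K :=
  \det (block_mx A (\col_i u_ (old i)) (rrow u v k) u%:M) / Dn.

Definition V (u v k : K) : K :=
  \det (block_mx A (\col_i v_ (old i)) (rrow u v k) v%:M) / Dn.

Definition X (x y l : K) : K :=
  \det (block_mx A (ccol x y l) (\row_j x_ (old j)) x%:M) / Dn.

Definition Y (x y l : K) : K :=
  \det (block_mx A (ccol x y l) (\row_j y_ (old j)) y%:M) / Dn.

(* Division is total; l_sub_k_neq0 and D_neq0 show that no denominator above
   vanishes at the indeterminates. *)

Lemma mxvec_index_inj (a b : 'I_6) (i j : 'I_n.+1) :
  mxvec_index a i = mxvec_index b j -> (a, i) = (b, j).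
Proof.
move=> e; case: (curry_mxvec_bij 6 n.+1) => g gK _.
by have := gK (a, i); have := gK (b, j); rewrite /= e => -> // ->.
Qed.

Lemma indet_inj (a b : 'I_6) (i j : 'I_n.+1) :
  indet a i = indet b j -> (a, i) = (b, j).
Proof.
move/eqP; rewrite tofrac_eq => /eqP e; apply: mxvec_index_inj.
have := congr1 (mcoeff U_(mxvec_index b j)) e.
rewrite !mcoeffXU eqxx; case: eqP => // _ /eqP.
by rewrite eq_sym oner_eq0.
Qed.

Lemma l_sub_k_neq0 (i j : 'I_n.+1) : l_ j - k_ i != 0.
Proof.
rewrite subr_eq0; apply/eqP => /indet_inj [] /(congr1 val).
by rewrite /= !inordK.
Qed.

(* Clear denominators, then specialise x, v := 0, y, u := 1, k := l: the matrix
   becomes diagonal. *)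
Lemma D_neq0 (m : nat) (le_mn : (m <= n.+1)%N) : D le_mn != 0.
Proof.
pose P := {mpoly F[6 * n.+1]}.
pose p (a : nat) (i : 'I_m) : P :=
  'X_(mxvec_index (inord a : 'I_6) (widen_ord le_mn i)).
pose B : 'M[P]_m := \matrix_(i, j)
  ((p 4 j * p 0 i - p 3 j * p 1 i) *
   \prod_(j' | j' != j) (p 5 j' - p 2 i)).
pose d : 'rV[K]_m := \row_i \prod_j tofrac (p 5 j - p 2 i).
have pE i j : tofrac (p 5 j - p 2 i) =
    l_ (widen_ord le_mn j) - k_ (widen_ord le_mn i).
  by rewrite rmorphB.
have BE : map_mx (@tofrac P) B = diag_mx d *m Amx le_mn.
  apply/matrixP => i j; rewrite mul_diag_mx !mxE [in RHS](bigD1 j) //= pE.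
  rewrite [RHS]mulrC mulrA mulfVK ?l_sub_k_neq0 //.
  by rewrite rmorphM rmorph_prod rmorphB !rmorphM.
suff: \det B != 0.
  apply: contra => /eqP D0; rewrite -tofrac_eq0 -det_map_mx BE det_mulmx.
  by rewrite -/(D le_mn) D0 mulr0.
pose s (a : 'I_6) (i : 'I_n.+1) : P :=
  [:: 1; 0; 'X_(mxvec_index (inord 5 : 'I_6) i); 0; 1;
      'X_(mxvec_index (inord 5 : 'I_6) i)]`_a.
pose phi : {rmorphism P -> P} :=
  comp_mpoly [tuple mxvec (\matrix_(a, i) s a i) 0 c | c < 6 * n.+1].
have phiE a i : phi (p a i) = s (inord a) (widen_ord le_mn i).
  rewrite /phi /p /= comp_mpolyXU -tnth_nth tnth_mktuple.
  by rewrite mxvecE mxE.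
pose q (i j : 'I_m) := p 5 j - p 5 i.
have phiB : map_mx phi B = diag_mx (\row_i \prod_(j | j != i) q i j).
  apply/matrixP => i j; rewrite !mxE rmorphM rmorph_prod rmorphB !rmorphM /=.
  rewrite !phiE // /s !inordK //= mul1r mul0r subr0 mul1r.
  have [<-|neq_ij] := eqVneq i j.
    rewrite mulr1n; apply: eq_bigr => j' _.
    by rewrite rmorphB /= !phiE // /s !inordK.
  by rewrite (bigD1 i) //= rmorphB /= !phiE // /s !inordK //= subrr mul0r.
suff: phi (\det B) != 0 by apply: contraNneq => ->; rewrite rmorph0.
rewrite -det_map_mx phiB det_diag; apply/prodf_neq0 => i _; rewrite mxE.
apply/prodf_neq0 => j neq_ji; rewrite subr_eq0; apply: contra neq_ji => /eqP e.
have /indet_inj[eij] :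
  l_ (widen_ord le_mn j) = l_ (widen_ord le_mn i) by congr tofrac.
by apply/eqP/val_inj.
Qed.

End BorderedDeterminants.

(* Main.v *)
Require Import Defs.
From mathcomp Require Import all_boot all_algebra ring.
From mathcomp.multinomials Require Import mpoly.

Import GRing.Theory.
Local Open Scope ring_scope.

(** Let [w = A^-1 c] and [z = r A^-1].  The Schur complement formula turns each
    quotient of determinants into a scalar: [U = u - z ucol], [V = v - z vcol],
    [X = x - xrow w], [Y = y - yrow w], and the left-hand side is
    [d - r A^-1 c] with [d = (y u - x v) / (l - k)]
    ([det_split_last], [det_bordered]).

    The denominators [l_j - k_i] enter only through displacement equations: with
    [L] and [M] the diagonal matrices of the [l_j] and of the [k_i],
    [A L - M A = ucol yrow - vcol xrow], [r L - k r = u yrow - v xrow] and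
    [l c - M c = y ucol - x vcol].  Expand [Y U - X V] and substitute these
    equations in the terms linear in [w], linear in [z] and bilinear in both.
    Since [z A = r] and [A w = c], the terms [r L w] and [z M c] appear with both
    signs and cancel, and what remains is [(l - k) (d - r A^-1 c)]
    ([displacement_schur]).

    The computation is valid in any field once the [l_j - k_i] and [\det A] are
    nonzero ([det_recursion]); for the indeterminates these conditions are
    [l_sub_k_neq0] and [D_neq0]. *)

(** This is the Schur complement; the matrix factors as a block lower triangular
    matrix times a block upper unitriangular one. *)
Lemma det_bordered (K : fieldType) (n : nat) (A : 'M[K]_n) (b : 'cV[K]_n)
    (r : 'rV[K]_n) (d : K) :
  A \in unitmx ->
  \det (block_mx A b r d%:M) = \det A * (d - (r *m invmx A *m b) 0 0).
Proof.
move=> Au.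
have -> : block_mx A b r d%:M =
    block_mx A 0 r (d%:M - r *m invmx A *m b) *m
    block_mx 1%:M (invmx A *m b) 0 1%:M.
  rewrite mulmx_block !mulmx1 !mulmx0 !addr0 mulmxA mulmxV // mul1mx.
  by rewrite mulmxA addrC subrK.
by rewrite det_mulmx det_lblock det_ublock !det1 !mulr1 det_mx11 !mxE mulr1n.
Qed.

(** [L] and [M] may be arbitrary matrices: in the computation they occur only
    inside [r L A^-1 c] and [r A^-1 M c], which cancel. *)
Lemma displacement_schur (K : fieldType) (n : nat) (A L M : 'M[K]_n)
    (uc vc c : 'cV[K]_n) (xr yr r : 'rV[K]_n) (u v k x y l d : K) :
  A \in unitmx ->
  A *m L - M *m A = uc *m yr - vc *m xr ->
  r *m L - k *: r = u *: yr - v *: xr ->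
  l *: c - M *m c = y *: uc - x *: vc ->
  (l - k) * d = y * u - x * v ->
  (y - (yr *m invmx A *m c) 0 0) * (u - (r *m invmx A *m uc) 0 0)
  - (x - (xr *m invmx A *m c) 0 0) * (v - (r *m invmx A *m vc) 0 0)
  = (l - k) * (d - (r *m invmx A *m c) 0 0).
Proof.
move=> Au dispA dispr dispc dispd.
set w := invmx A *m c; set z := r *m invmx A.
have Aw : A *m w = c by rewrite /w mulmxA mulmxV ?mul1mx.
have zA : z *m A = r by rewrite /z mulmxKV.
have mul11 (P Q : 'M[K]_1) : (P *m Q) 0 0 = P 0 0 * Q 0 0.
  by rewrite mxE big_ord1.
have sub11 (P Q : 'M[K]_1) : (P - Q) 0 0 = P 0 0 - Q 0 0 by rewrite !mxE.
have scale11 a (P : 'M[K]_1) : (a *: P) 0 0 = a * P 0 0 by rewrite mxE.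
have Er : (r *m L *m w) 0 0 - k * (r *m w) 0 0
          = u * (yr *m w) 0 0 - v * (xr *m w) 0 0.
  by rewrite -!scale11 -!sub11 !scalemxAl -!mulmxBl dispr.
have Ec : l * (r *m w) 0 0 - (z *m M *m c) 0 0
          = y * (z *m uc) 0 0 - x * (z *m vc) 0 0.
  have -> : r *m w = z *m c by rewrite -Aw mulmxA zA.
  by rewrite -!scale11 -!sub11 !scalemxAr -mulmxA -!mulmxBr dispc.
have EA : (r *m L *m w) 0 0 - (z *m M *m c) 0 0
          = (z *m uc) 0 0 * (yr *m w) 0 0 - (z *m vc) 0 0 * (xr *m w) 0 0.
  rewrite -!mul11 -!sub11 -[in LHS]zA -[in LHS]Aw.
  have -> : z *m A *m L *m w - z *m M *m (A *m w)
            = z *m (A *m L - M *m A) *m w by rewrite mulmxBr mulmxBl !mulmxA.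
  by rewrite dispA mulmxBr mulmxBl !mulmxA.
rewrite -![_ *m invmx A *m c]mulmxA -/w [in RHS]mulrBr dispd.
(* The subtracted and added terms are the right-hand sides of Er, Ec and EA. *)
transitivity (y * u - x * v
  - (u * (yr *m w) 0 0 - v * (xr *m w) 0 0)
  - (y * (z *m uc) 0 0 - x * (z *m vc) 0 0)
  + ((z *m uc) 0 0 * (yr *m w) 0 0 - (z *m vc) 0 0 * (xr *m w) 0 0)).
  by ring.
by rewrite -Er -Ec -EA; ring.
Qed.


(** Stated for an arbitrary equality of sizes so that it can be eliminated; it
    bridges the sizes [n + 1] of a block matrix and [n.+1]. *)
Lemma det_cast_ord (R : comPzRingType) (p q : nat) (e : p = q) (B : 'M[R]_p)
    (C : 'M[R]_q) :
  (forall i j, C (cast_ord e i) (cast_ord e j) = B i j) -> \det C = \det B.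
Proof.
case: q / e C => C BC; congr (\det _); apply/matrixP => i j.
by rewrite -BC !cast_ord_id.
Qed.

Lemma det_split_last (R : comPzRingType) (n : nat)
    (f : 'I_n.+1 -> 'I_n.+1 -> R) :
  let old := widen_ord (leqnSn n) in
  \det (\matrix_(i, j) f i j) =
  \det (block_mx (\matrix_(i, j) f (old i) (old j)) (\col_i f (old i) ord_max)
                 (\row_j f ord_max (old j)) (f ord_max ord_max)%:M).
Proof.
move=> old.
have castl i : cast_ord (addn1 n) (lshift 1 i) = old i by exact: val_inj.
have castr i : cast_ord (addn1 n) (rshift n i) = ord_max.
  by apply: val_inj; rewrite /= ord1 addn0.
apply: (@det_cast_ord _ _ _ (addn1 n)) => i j.
by case: (split_ordP i) => i' ->; case: (split_ordP j) => j' ->;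
   rewrite ?(block_mxEul, block_mxEur, block_mxEdl, block_mxEdr) !mxE
           ?castl ?castr // !ord1 mulr1n.
Qed.

Section Recursion.
Variables (K : fieldType) (n : nat) (u v k x y l : 'I_n.+1 -> K).

Let a i j := (y j * u i - x j * v i) / (l j - k i).
Let old := widen_ord (leqnSn n).
Let last : 'I_n.+1 := ord_max.
Let A : 'M[K]_n := \matrix_(i, j) a (old i) (old j).
Let c : 'cV[K]_n := \col_i a (old i) last.
Let r : 'rV[K]_n := \row_j a last (old j).

(** The displacement equations hold because multiplication of [A], [r], [c] by
    diagonal matrices and scalars clears the denominators entrywise ([aE]). *)
Lemma det_recursion :
  (forall i j, l j - k i != 0) -> \det A != 0 ->
  \det (\matrix_(i, j) a i j) / \det A =
  (\det (block_mx A c (\row_j y (old j)) (y last)%:M) / \det A *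
   (\det (block_mx A (\col_i u (old i)) r (u last)%:M) / \det A) -
   \det (block_mx A c (\row_j x (old j)) (x last)%:M) / \det A *
   (\det (block_mx A (\col_i v (old i)) r (v last)%:M) / \det A))
  / (l last - k last).
Proof.
move=> lk0 A0.
have Au : A \in unitmx by rewrite unitmxE unitfE.
have aE i j : a i j * (l j - k i) = y j * u i - x j * v i by rewrite divfK.
pose L := diag_mx (\row_j l (old j)).
pose M := diag_mx (\row_i k (old i)).
rewrite det_split_last !det_bordered // ![\det A * _]mulrC !mulfK //.
rewrite (@displacement_schur _ _ A L M _ _ _ _ _ _ _ _ (k last) _ _ (l last)
           (a last last)) //; last 1 first.
- by rewrite mulrC aE.
- by rewrite mulrC mulKf.
- apply/matrixP => i j; rewrite mul_mx_diag mul_diag_mx !mxE !big_ord1 !mxE.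
  by rewrite [k _ * _]mulrC -mulrBr aE mulrC [v _ * _]mulrC.
- apply/rowP => j; rewrite mul_mx_diag !mxE.
  by rewrite [k _ * _]mulrC -mulrBr aE mulrC [v _ * _]mulrC.
- apply/colP => i; rewrite mul_diag_mx !mxE.
  by rewrite -mulrBl mulrC aE.
Qed.

End Recursion.

Theorem mainTheorem1 (F : fieldType) (n : nat) (n_ge1 : (1 <= n)%N) :
  let u : ratfun F n := u_ F ord_max in
  let v : ratfun F n := v_ F ord_max in
  let k : ratfun F n := k_ F ord_max in
  let x : ratfun F n := x_ F ord_max in
  let y : ratfun F n := y_ F ord_max in
  let l : ratfun F n := l_ F ord_max in
  D F (leqnn n.+1) / D F (leqnSn n) =
    (Y x y l * U u v k - X x y l * V u v k) / (l - k).
Proof.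
move=> u v k x y l.
(* The size bound m <= n.+1 in D makes even the full matrix use widen_ord. *)
have widen_id i : widen_ord (leqnn n.+1) i = i by exact: val_inj.
have -> : D F (leqnn n.+1) = \det (\matrix_(i, j)
    ((y_ F j * u_ F i - x_ F j * v_ F i) / (l_ F j - k_ F i))).
  by congr (\det _); apply/matrixP => i j; rewrite mxE [RHS]mxE !widen_id.
apply: (@det_recursion _ n (u_ F (n:=n)) (v_ F (n:=n)) (k_ F (n:=n))
                       (x_ F (n:=n)) (y_ F (n:=n)) (l_ F (n:=n))).
  by move=> i j; apply: l_sub_k_neq0.
exact: (D_neq0 F (leqnSn n)).
Qed.
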